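(* Let $A,B\in B(H)$ be such that $A$ is positive and $B$ is self-adjoint. If $AB$ is hyponormal, then $AB$ is self-adjoint. Likewise, if $BA$ is hyponormal, then $BA$ is self-adjoint.
   Context: $H$ is a complex separable Hilbert space with $\dim H=\infty$; $B(H)$ is the set of bounded linear operators on $H$. Positive means $\langle Ax,x\rangle\geq 0$ for all $x\in H$. An operator $T\in B(H)$ is hyponormal if $\|T^*x\|\leq\|Tx\|$ for all $x\in H$. *)

(* Defs.v *)
From HB Require Import structures.
From mathcomp Require Import all_boot all_order all_algebra.
From mathcomp Require Import all_classical all_reals all_analysis.
From mathcomp Require Import complex.
From mathcomp Require Import ring lra.

Set Implicit Arguments.
Unset Strict Implicit.
Unset Printing Implicit Defensive.

Import Order.TTheory GRing.Theory Num.Theory.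
Import numFieldNormedType.Exports.

Local Open Scope classical_set_scope.
Local Open Scope ring_scope.
Local Open Scope complex_scope.

(* The inner product is linear in its first argument and conjugate-linear in
   the second one. *)
Record hilbertType (R : realType) := Hilbert {
  hilbert_sort :> completeNormedModType R[i] ;
  inner : {dot hilbert_sort for (@Num.conj R[i])} ;
  norm_inner : forall x, `|x| = sqrtC (inner x x) }.

Section Defs.
Context {R : realType}.

Definition separable (H : hilbertType R) : Prop :=
  exists2 D : set H, countable D & dense D.

Definition infinite_dimensional (H : hilbertType R) : Prop :=
  ~ exists (n : nat) (v : 'I_n -> H), forall x : H,
      exists c : 'I_n -> R[i], x = \sum_(i < n) c i *: v i.

Section Riesz.
Local Notation Re := complex.Re.
Local Notation Im := complex.Im.
Variable H : hilbertType R.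

(* N x = |x|^2 and Q g = |g|^2 as elements of R; the vector representing a
   bounded linear functional f is the minimizer of J f. *)
Let N (x : H) : R := Re (inner H x x).
Let Q (g : R[i]) : R := Re g ^+ 2 + Im g ^+ 2.
Let J (f : H -> R[i]) (x : H) : R := N x - 2 * Re (f x).

Let ReD (a b : R[i]) : Re (a + b) = Re a + Re b.
Proof. by case: a b => ? ? []. Qed.

Let inner_N x : inner H x x = (N x)%:C.
Proof.
by rewrite /N RRe_real // ger0_real // (dnorm_ge0 (inner H)).
Qed.

Let norm_N (x : H) : `|x| ^+ 2 = (N x)%:C.
Proof. by rewrite norm_inner sqrtCK inner_N. Qed.

Let N_ge0 x : 0 <= N x.
Proof. by rewrite -(@lecR R) -norm_N exprn_ge0. Qed.

Let normE (x : H) : `|x| = (Re `|x|)%:C.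
Proof. by rewrite RRe_real // ger0_real. Qed.

Let Renorm_ge0 (x : H) : 0 <= Re `|x|.
Proof. by have := normr_ge0 x; rewrite normE lecR. Qed.

Let Renorm_N (x : H) : Re `|x| ^+ 2 = N x.
Proof. by apply: complexI; rewrite rmorphXn /= -normE norm_N. Qed.

Let N_add x h t : N (x + t *: h) =
  N x + Q t * N h + 2 * Re (t * inner H h x).
Proof.
rewrite /N dnormD dnormZ -add_Re2_Im2 !ReD (inner_N h) linearZr_LR/=.
rewrite (hermC (inner H) x h) /= expr0 mul1r.
case: (inner H h x) => a b; case: t => c d; rewrite /Q /=; ring.
Qed.

Lemma inner_norm_le (x y : H) : `|inner H x y| <= `|x| * `|y|.
Proof.
have [->|x0] := eqVneq x 0; first by rewrite linear0l normr0 mulr_ge0.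
have n0 : 0 < N x.
  by rewrite -(@ltcR R) -inner_N (dnorm_gt0 (inner H)).
rewrite -(@ler_pXn2r _ 2) // ?nnegrE ?mulr_ge0 // exprMn !norm_N.
rewrite -add_Re2_Im2 -rmorphM lecR -/(Q _); set g := inner H x y.
have := N_ge0 (y + (- ((N x)^-1%:C * g^*%C)) *: x).
rewrite N_add -/g.
have -> : Q (- ((N x)^-1%:C * g^*)%C) = (N x)^-1 ^+ 2 * Q g.
  by case: (g) => a b; rewrite /Q /=; ring.
have -> : Re (- ((N x)^-1%:C * g^*)%C * g) = - (N x)^-1 * Q g.
  by case: (g) => a b; rewrite /Q /=; ring.
have -> : N y + (N x)^-1 ^+ 2 * Q g * N x + 2 * (- (N x)^-1 * Q g) =
          N y - Q g / N x by field; rewrite gt_eqF.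
by rewrite subr_ge0 ler_pdivrMr // mulrC.
Qed.

Let quad (f : H -> R[i]) (fD : forall u v, f (u + v) = f u + f v)
    (fZ : forall a u, f (a *: u) = a * f u) x h d :
  (forall t, J f x - d <= J f (x + t *: h)) ->
  Q (inner H h x - f h) <= d * (N h + 1).
Proof.
move=> le_J; set g := _ - _.
have n0 := N_ge0 h; have n1 : 0 < N h + 1 by rewrite ltr_wpDl.
pose s := (N h + 1)^-1; have s0 : 0 < s by rewrite invr_gt0.
have := le_J (- (s%:C * g^*%C)).
rewrite /J N_add fD fZ ReD.
have -> : inner H h x = g + f h by rewrite subrK.
rewrite mulrDr ReD.
have -> : Q (- (s%:C * g^*)%C) = s ^+ 2 * Q g.
  by case: (g) => a b; rewrite /Q /=; ring.
have -> : Re (- (s%:C * g^*)%C * g) = - s * Q g.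
  by case: (g) => a b; rewrite /Q /=; ring.
set r := Re (_ * f h) => le1.
have Qg : 0 <= Q g by rewrite addr_ge0 ?sqr_ge0.
have sn : s * (N h + 1) = 1 by rewrite mulVf // gt_eqF.
have -> : Q g = (s * Q g) * (N h + 1) by rewrite mulrAC sn mul1r.
rewrite ler_pM2r //.
have : s ^+ 2 * Q g * N h <= s * Q g.
  have -> : s ^+ 2 * Q g * N h = s * Q g * (s * (N h + 1) - s) by ring.
  rewrite sn ler_piMr ?mulr_ge0 ?(ltW s0) // lerBlDr lerDl ltW //.
by lra.
Qed.

Lemma riesz (f : H -> R[i]) (M : R[i]) :
  (forall u v, f (u + v) = f u + f v) ->
  (forall a u, f (a *: u) = a * f u) ->
  (forall x, `|f x| <= M * `|x|) -> exists z, forall x, f x = inner H x z.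
Proof.
move=> fD fZ fM.
pose m := Re M.
have fm x : Re (f x) <= m * Re `|x|.
  have := le_trans (normc_ge_Re (f x)) (fM x).
  rewrite (normE x) lecE /= => /andP[_].
  case: (M) @m => a b m /=; rewrite mulr0 subr0; apply: le_trans.
  exact: ler_norm.
have J_ge x : - m ^+ 2 <= J f x.
  rewrite /J -Renorm_N; have := fm x; have := sqr_ge0 (Re `|x| - m).
  by rewrite sqrrB; lra.
pose S := range (J f).
have S0 : S !=set0 by exists (J f 0); exists 0.
have Slb : has_inf S.
  by split=> //; exists (- m ^+ 2) => _ [x _ <-].
pose I := inf S.
have I_le x : I <= J f x by apply: ge_inf; [case: Slb | exists x].
pose F := filter_from [set e : R | 0 < e] (fun e => [set x | J f x < I + e]).
have FF : ProperFilter F.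
  apply: filter_from_proper; first apply: filter_from_filter.
  - by exists 1 => /=.
  - move=> i j i0 j0; exists (Num.min i j); first by rewrite /= lt_min i0.
    move=> x /= /lt_le_trans lx; split; apply: lx; rewrite lerD2l ge_min lexx //.
    by rewrite orbT.
  - move=> e e0; have [_ [x _ <-] xe] := inf_adherent e0 Slb.
    by exists x.
have Nball x y (e : R) : 0 < e -> N (x - y) < e ^+ 2 -> ball x e%:C y.
  move=> e0; rewrite -ball_normE /= (normE (_ - _)) ltcR -Renorm_N.
  by rewrite ltr_pXn2r ?nnegrE // ltW.
have ballN x y (e : R) : 0 < e -> ball x e%:C y -> N (x - y) < e ^+ 2.
  move=> e0; rewrite -ball_normE /= (normE (_ - _)) ltcR -Renorm_N.
  by rewrite ltr_pXn2r ?nnegrE // ltW.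
have eC (e : R[i]) : 0 < e -> exists2 r : R, 0 < r & e = r%:C.
  move=> e0; have eE : (Re e)%:C = e by rewrite RRe_real // gtr0_real.
  by exists (Re e) => //; rewrite -(@ltcR R) eE.
have par x y : N (x - y) = 2 * J f x + 2 * J f y - 4 * J f (2^-1 *: (x + y)).
  have -> : x - y = x + (-1) *: y by rewrite scaleN1r.
  have -> : 2^-1 *: (x + y) = 2^-1 *: (x + 1 *: y) by rewrite scale1r.
  rewrite /J; have -> : N (2^-1 *: (x + 1 *: y)) = 4^-1 * N (x + 1 *: y).
    rewrite {1}/N dnormZ inner_N.
    have -> : `|2^-1 : R[i]| ^+ 2 = (4^-1 : R)%:C.
      rewrite ger0_norm ?invr_ge0 ?ler0n // exprVn -natrX.
      by rewrite rmorphV ?unitfE ?pnatr_eq0 // rmorph_nat.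
    by rewrite -rmorphM.
  rewrite !N_add fZ fD scale1r.
  have -> : Re (2^-1 * (f x + f y)) = 2^-1 * (Re (f x) + Re (f y)).
    have -> : (2^-1 : R[i]) = (2^-1 : R)%:C.
      by rewrite rmorphV ?unitfE ?pnatr_eq0 // rmorph_nat.
    by case: (f x) (f y) => ? ? [? ?] /=; ring.
  rewrite mulN1r mul1r; case: (inner H y x) => a b; rewrite /Q /=; by field.
have cF : cauchy F.
  apply: cauchy_exP => e /eC [r rp ->].
  have r0 : 0 < r ^+ 2 / 4 by rewrite divr_gt0 ?exprn_gt0.
  have [_ [x _ <-] xe] := inf_adherent r0 Slb.
  exists x; exists (r ^+ 2 / 4) => // y /= ye.
  apply: Nball => //; rewrite par.
  have := I_le (2^-1 *: (x + y)); rewrite -/I in xe.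
  by lra.
have [z Fz] := (cvg_ex F).1 (cauchy_cvg F cF).
exists z => h; apply/esym/eqP; rewrite -subr_eq0; set g := _ - _.
have Qge (a : R[i]) : 0 <= Q a by rewrite addr_ge0 ?sqr_ge0.
suff : Q g <= 0.
  move=> Qg; have Q0 : Q g = 0 by apply/eqP; rewrite eq_le Qg Qge.
  move/eqP: Q0; rewrite paddr_eq0 ?sqr_ge0 // !sqrf_eq0 => /andP[/eqP r0 /eqP i0].
  by rewrite eq_complex r0 i0 eqxx.
have n1 : 0 < N h + 1 by rewrite ltr_wpDl.
have bound (e : R) : 0 < e -> Q g <= 4 * (N h + 1) * e ^+ 2.
  move=> e0.
  have e20 : 0 < e ^+ 2 by rewrite exprn_gt0.
  have Fb : F (ball z e%:C) by apply: Fz; apply: nbhsx_ballx; rewrite ltcR.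
  have FS : F [set x | J f x < I + e ^+ 2] by exists (e ^+ 2).
  have [x [/= bx Jx]] := filter_ex (filterI Fb FS).
  have {}bx := ballN _ _ _ e0 bx.
  have q1 : Q (inner H h x - f h) <= e ^+ 2 * (N h + 1).
    by apply: quad => // t; have := I_le (x + t *: h); lra.
  have q2 : Q (inner H h (z - x)) <= e ^+ 2 * (N h + 1).
    apply: le_trans (_ : N (z - x) * (N h + 1) <= _); last first.
      by rewrite ler_pM2r // ltW.
    have := @quad (fun=> 0) _ _ (z - x) h (N (z - x)).
    rewrite subr0; apply => [u v|a u|t]; rewrite ?addr0 ?mulr0 //.
    rewrite /J /= mulr0 !subr0 subrr.
    exact: N_ge0.
  have -> : g = (inner H h x - f h) + inner H h (z - x).
    by rewrite linearBr /=; rewrite /g; ring.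
  move: q1 q2; case: (_ - _) (inner H h (z - x)) => a b [c d].
  rewrite /Q /= => q1 q2.
  have := sqr_ge0 (a - c); have := sqr_ge0 (b - d); rewrite !sqrrB !sqrrD.
  by lra.
rewrite leNgt; apply/negP => Qg0.
pose e := Num.sqrt (Q g / (8 * (N h + 1))).
have p0 : 0 < Q g / (8 * (N h + 1)) by rewrite divr_gt0 ?mulr_gt0.
have := bound e; rewrite sqrtr_gt0 => /(_ p0); rewrite sqr_sqrtr ?(ltW p0) //.
have -> : 4 * (N h + 1) * (Q g / (8 * (N h + 1))) = Q g / 2.
  by field; rewrite gt_eqF.
by lra.
Qed.

End Riesz.

Context {H : hilbertType R}.
Implicit Type T : H -> H.

Definition bounded_operator (T : {linear H -> H}) : Prop :=
  exists M : R[i], forall x, `|T x| <= M * `|x|.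

(* The Hilbert adjoint: [adjoint T y] is the vector z, given by the Riesz
   representation theorem, such that <T x, y> = <x, z> for all x. The default
   value 0 is never used on bounded operators, see [adjointP] below. *)
Definition adjoint T : H -> H := fun y =>
  xget 0 [set z | forall x, inner H (T x) y = inner H x z].

Lemma adjointP (T : {linear H -> H}) : bounded_operator T ->
  forall x y, inner H (T x) y = inner H x (adjoint T y).
Proof.
move=> [M TM] x y; rewrite /adjoint; case: xgetP => [z _ //|noz].
have [||u|z Tz] := @riesz H (fun x => inner H (T x) y) (M * `|y|).
- by move=> u v; rewrite !linearD linearDl.
- by move=> a u; rewrite linearZ linearZl_LR.
- by apply: le_trans (inner_norm_le _ _) _; rewrite mulrAC ler_wpM2r.
- by case: (noz z) => ?; exact: Tz.
Qed.

Lemma adjoint_unique T y z :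
  (forall x, inner H (T x) y = inner H x z) -> adjoint T y = z.
Proof.
move=> Tz; rewrite /adjoint; case: xgetP => [z' _ Tz'|/(_ z) []//].
apply/eqP; rewrite -subr_eq0 -(dnorm_eq0 (inner H)) linearBr /= -Tz' -Tz.
by rewrite subrr.
Qed.

Definition self_adjoint T : Prop := adjoint T = T.

(* In R[i], 0 <= z means that z is real and nonnegative. *)
Definition positive_operator T : Prop := forall x, 0 <= inner H (T x) x.

Definition hyponormal T : Prop := forall x, `|adjoint T x| <= `|T x|.

End Defs.

(* Main.v *)
Require Import Defs.
From mathcomp Require Import all_boot all_order all_algebra.
From mathcomp Require Import all_classical all_reals all_analysis.
From mathcomp Require Import complex.
From mathcomp Require Import ring lra.

Set Implicit Arguments.
Unset Strict Implicit.
Unset Printing Implicit Defensive.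

Import Order.TTheory GRing.Theory Num.Theory.
Import numFieldNormedType.Exports.

(** Let T be AB or BA. Heuristically, BA is symmetric for the semi-inner product
<Ax,y>, so it has real spectrum, and so has AB, whose nonzero spectrum is the
same; a hyponormal operator with real spectrum is self-adjoint, because a
hyponormal operator has norm equal to its spectral radius. The proof makes this
quantitative, and uses neither spectra nor the square root of [A].

For real h, put V = 1 + ihT, the operator [istep T h]. If T = BA, then the
cross terms of <AVx,Vx> cancel, so <AVx,Vx> <= (1 + ch^2) <Ax,x> for a constant
c that depends only on the bounds of [A] and [B]. With |Ax|^2 <= a <Ax,x> this
bounds |AV^n x| by a q^n |x|, where q = 1 + ch^2 ([iter_istep_mulA_le]). Since
V^(n+1) = V^n + ihB(AV^n), the powers of V satisfy
|V^n x| <= (1 + nK) q^n |x| ([istep_BA_growth]); the case T = AB is reduced to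
the same estimate by the intertwining A(BA) = (AB)A ([istep_AB_growth]).

On the other hand V is hyponormal when T is, and then the sequence |V^n x| is
log-convex ([istep_log_convex]): it grows at least like the powers of
|Vx|/|x|. The factor 1 + nK cannot compensate an exponential, so
|Vx| <= (1 + ch^2) |x|. The square of the left-hand side is
|x|^2 - 2h Im <Tx,x> + h^2 |Tx|^2, and letting h tend to 0 from both sides
gives Im <Tx,x> = 0 ([hyponormal_slow_symmetric]). By polarization T is
symmetric, hence self-adjoint. *)

Local Open Scope ring_scope.
Local Open Scope complex_scope.
Local Notation Re := complex.Re.
Local Notation Im := complex.Im.

(** * Log-convex real sequences *)

Section RealSequences.
Context {R : realType}.
Implicit Types (u : nat -> R) (K b e q s : R).

Lemma expr_le_quadratic_le1 s K : 0 <= s -> 0 <= K ->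
  (forall n, s ^+ n <= (1 + n%:R * K) ^+ 2) -> s <= 1.
Proof.
move=> s0 K0 sK; rewrite leNgt; apply/negP => s1.
pose d := s - 1; have d0 : 0 < d by rewrite subr_gt0.
have bern m : 1 + m%:R * d <= s ^+ m.
  elim: m => [|m IH]; first by rewrite mul0r addr0 expr0.
  have m0 : 0 <= m%:R * d by rewrite mulr_ge0 ?ler0n // ltW.
  have : s * (1 + m%:R * d) <= s ^+ m.+1 by rewrite exprS ler_wpM2l.
  apply: le_trans; rewrite -natr1 (_ : s = 1 + d); last by rewrite /d; ring.
  by nra.
(* The exponent 4m is used because s ^ (4m) >= (1 + m d) ^ 4 is quartic in m,
   which beats the square of the linear function 1 + 4mK. *)
pose m := (Num.truncn (4 * K / d ^+ 2)).+1.
have mK : 4 * K < m%:R * d ^+ 2.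
  by rewrite -ltr_pdivrMr ?exprn_gt0 // truncnS_gt.
have m0 : 0 < m%:R :> R by rewrite ltr0n.
have md0 : 0 < m%:R * d by rewrite mulr_gt0.
have lt2 : 1 + (4 * m)%:R * K < (1 + m%:R * d) ^+ 2.
  rewrite natrM sqrrD expr1n mul1r exprMn.
  have : m%:R * (4 * K) < m%:R * (m%:R * d ^+ 2) by rewrite ltr_pM2l.
  by nra.
have := sK (4 * m)%N; apply/negP; rewrite -ltNge.
have -> : s ^+ (4 * m) = ((s ^+ m) ^+ 2) ^+ 2.
  by rewrite -!exprM mulnC.
rewrite ltr_pXn2r ?nnegrE ?exprn_ge0 ?addr_ge0 ?mulr_ge0 ?exprn_ge0 //.
apply: lt_le_trans lt2 _; rewrite lerXn2r ?nnegrE ?exprn_ge0 //.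
by rewrite addr_ge0 // ltW.
Qed.

(** Log-convexity makes the ratios u (n+1) / u n nondecreasing; the product form
keeps its meaning when some u n vanishes. *)
Lemma log_convex_ratio u : (forall n, 0 <= u n) ->
  (forall n, u n.+1 ^+ 2 <= u n * u n.+2) ->
  forall n, u 1 * u n <= u 0 * u n.+1.
Proof.
move=> u0 uconv; elim=> [|n IH]; first by rewrite mulrC.
have [un|] := eqVneq (u n) 0.
  have : u n.+1 ^+ 2 <= 0 by have := uconv n; rewrite un mul0r.
  rewrite real_exprn_even_le0 ?num_real //= => /eqP->.
  by rewrite mulr0 mulr_ge0.
move=> nz; have un : 0 < u n by rewrite lt0r nz u0.
rewrite -(ler_pM2r un).
have le1 : u 1 * u n * u n.+1 <= u 0 * u n.+1 * u n.+1 by rewrite ler_wpM2r.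
have le2 : u 0 * u n.+1 ^+ 2 <= u 0 * (u n * u n.+2) by rewrite ler_wpM2l.
by nra.
Qed.

(** A log-convex sequence dominates the geometric sequence with the same first
two terms, so an upper bound of exponential rate q, even with a polynomial loss,
already bounds the first ratio by q, without loss. *)
Lemma log_convex_growth u K q : (forall n, 0 <= u n) ->
  (forall n, u n.+1 ^+ 2 <= u n * u n.+2) -> 0 < q -> 0 <= K ->
  (forall n, u n <= (1 + n%:R * K) ^+ 2 * q ^+ n * u 0) -> u 1 <= q * u 0.
Proof.
move=> u0 uconv q0 K0 ub.
have [uz|un] := eqVneq (u 0) 0.
  by have := ub 1; rewrite uz !mulr0.
have {un} up : 0 < u 0 by rewrite lt0r un u0.
rewrite -ler_pdivrMr // -[q]mul1r -ler_pdivrMr //.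
apply: (@expr_le_quadratic_le1 _ K) => // [|n].
  by rewrite !divr_ge0 // ltW.
rewrite expr_div_n ler_pdivrMr ?exprn_gt0 // -(ler_pM2r up).
apply: le_trans (ub n).
elim: n {ub} => [|n IH]; first by rewrite expr0 mul1r.
have : u 1 * u n <= u 0 * u n.+1 by apply: log_convex_ratio.
rewrite -ler_pdivrMl // => /(le_trans _); apply.
rewrite mulrA [_^-1 * _]mulrC exprS -mulrA ler_wpM2l //.
by rewrite divr_ge0 // ltW.
Qed.

Lemma geometric_increments_le u b e : 1 <= b -> 0 <= u 0 -> 0 <= e ->
  (forall n, u n.+1 <= u n + e * b ^+ n * u 0) ->
  forall n, u n <= (1 + n%:R * e) * b ^+ n * u 0.
Proof.
move=> b1 u0 e0 ub; elim=> [|n IH]; first by rewrite mul0r addr0 expr0 !mul1r.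
apply: le_trans (ub n) _.
have bn : 0 <= b ^+ n by rewrite exprn_ge0 // (le_trans ler01).
apply: le_trans (_ : (1 + n.+1%:R * e) * b ^+ n * u 0 <= _).
  by rewrite -natr1; move: IH; lra.
rewrite ler_wpM2r // ler_wpM2l ?addr_ge0 ?mulr_ge0 //.
by rewrite exprS ler_peMl.
Qed.

End RealSequences.

(** * The real inner product *)

Section RealForm.
Context {R : realType} {H : hilbertType R}.
Implicit Types (x y z : H) (h : R).

(** The norm and the inner product of H take their values in R[i], where the
order is partial. All the estimates only involve real quantities, and are made
in R with the real inner product Re <x,y>, its square norm and its norm. *)
Definition rdot x y : R := Re (inner H x y).
Definition sqn x : R := rdot x x.
Definition rnorm x : R := Re `|x|.

Definition adjoint_pair (T T' : H -> H) : Prop :=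
  forall x y, inner H (T x) y = inner H x (T' y).

Definition symmetric (T : H -> H) : Prop := adjoint_pair T T.

Lemma innerC x y : inner H x y = (inner H y x)^*.
Proof. by rewrite (hermC (inner H)) /= expr0 mul1r. Qed.

Lemma innerDl x y z : inner H (x + y) z = inner H x z + inner H y z.
Proof. by rewrite linearDl. Qed.

Lemma innerDr x y z : inner H z (x + y) = inner H z x + inner H z y.
Proof. by rewrite linearD. Qed.

Lemma rdotC x y : rdot x y = rdot y x.
Proof. by rewrite /rdot innerC; case: (inner H y x). Qed.

Lemma rdotDl x y z : rdot (x + y) z = rdot x z + rdot y z.
Proof.
by rewrite /rdot innerDl; case: (inner H x z) (inner H y z) => ? ? [].
Qed.

Lemma rdotDr x y z : rdot z (x + y) = rdot z x + rdot z y.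
Proof. by rewrite !(rdotC z) rdotDl. Qed.

Lemma rdotZl (c : R) x y : rdot (c%:C *: x) y = c * rdot x y.
Proof.
by rewrite /rdot linearZl_LR /=; case: (inner H x y) => a b /=; ring.
Qed.

Lemma rdotZr (c : R) x y : rdot x (c%:C *: y) = c * rdot x y.
Proof. by rewrite rdotC rdotZl rdotC. Qed.

Lemma rdot_il h x y : rdot ((0 +i* h) *: x) y = - h * Im (inner H x y).
Proof.
by rewrite /rdot linearZl_LR /=; case: (inner H x y) => a b /=; ring.
Qed.

Lemma sqnE x : sqn x = rnorm x ^+ 2.
Proof.
rewrite /sqn /rdot /rnorm.
have E : `|x| ^+ 2 = inner H x x by rewrite norm_inner sqrtCK.
have n0 := normr_ge0 x.
have -> : inner H x x = (Re `|x| ^+ 2)%:C.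
  by rewrite rmorphXn /= RRe_real ?E // ger0_real.
by [].
Qed.

Lemma normE x : `|x| = (rnorm x)%:C.
Proof. by rewrite /rnorm RRe_real // ger0_real. Qed.

Lemma rnorm_ge0 x : 0 <= rnorm x.
Proof. by have := normr_ge0 x; rewrite normE lecR. Qed.

Lemma sqn_ge0 x : 0 <= sqn x.
Proof. by rewrite sqnE sqr_ge0. Qed.

Lemma rnormD x y : rnorm (x + y) <= rnorm x + rnorm y.
Proof. by have := ler_normD x y; rewrite !normE -rmorphD /= lecR. Qed.

Lemma ler_rnorm x (c : R) : 0 <= c -> (rnorm x <= c) = (sqn x <= c ^+ 2).
Proof. by move=> c0; rewrite sqnE ler_pXn2r // ?nnegrE ?rnorm_ge0. Qed.

Lemma rdot_le x y : rdot x y <= rnorm x * rnorm y.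
Proof.
rewrite -lecR rmorphM /= -!normE; apply: le_trans (inner_norm_le x y).
apply: le_trans (normc_ge_Re _); rewrite lecR; exact: ler_norm.
Qed.

Lemma sqnD x y : sqn (x + y) = sqn x + 2 * rdot y x + sqn y.
Proof. by rewrite /sqn rdotDl !rdotDr (rdotC x y); ring. Qed.

Lemma rdot_ii h x y :
  rdot ((0 +i* h) *: x) ((0 +i* h) *: y) = h ^+ 2 * rdot x y.
Proof.
rewrite rdot_il innerC linearZl_LR /= /rdot (innerC x).
by case: (inner H y x) => a b /=; ring.
Qed.

Lemma sqn_i h x : sqn ((0 +i* h) *: x) = h ^+ 2 * sqn x.
Proof. exact: rdot_ii. Qed.

Lemma rnorm_i h x : rnorm ((0 +i* h) *: x) = `|h| * rnorm x.
Proof.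
apply/eqP; rewrite -(@eqrXn2 _ 2) ?mulr_ge0 ?rnorm_ge0 //.
by rewrite exprMn -!sqnE sqn_i real_normK ?num_real.
Qed.

(** Polarization at x + y and at x + i y; this is where complex scalars are
essential. *)
Lemma symmetric_real (T : {linear H -> H}) :
  (forall x, Im (inner H (T x) x) = 0) -> symmetric T.
Proof.
move=> T0 x y.
have [Ix Iy] := (T0 x, T0 y).
have := T0 (x + y); have := T0 (x + (0 +i* 1) *: y).
have conjZ u : inner H u ((0 +i* 1) *: y) = (0 -i* 1) * inner H u y.
  rewrite innerC linearZl_LR /= (innerC u).
  case: (inner H y u) => a b; apply/eqP; rewrite eq_complex /=.
  by apply/andP; split; apply/eqP; ring.
rewrite (innerC x (T y)) !linearD linearZ /= !(innerDl, innerDr).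
rewrite !linearZl_LR /= !conjZ.
move: Ix Iy.
case: (inner H (T x) x) (inner H (T y) y) => a1 b1 [a2 b2].
case: (inner H (T x) y) (inner H (T y) x) => a3 b3 [a4 b4] /=.
move=> -> -> E1 E2; apply/eqP; rewrite eq_complex /=.
by apply/andP; split; apply/eqP; lra.
Qed.

Lemma bounded_operator_real (T : {linear H -> H}) : bounded_operator T ->
  exists2 a : R, 0 < a & forall x, rnorm (T x) <= a * rnorm x.
Proof.
move=> [M TM]; exists (`|Re M| + 1); first by rewrite ltr_wpDl.
move=> x; have := TM x; rewrite !normE lecE /= => /andP[_].
case: M {TM} => a b /=; rewrite mulr0 subr0 => /le_trans; apply.
apply: ler_wpM2r; first exact: rnorm_ge0.
by apply: le_trans (ler_norm a) _; rewrite lerDl.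
Qed.

End RealForm.

(** * The operators 1 + ihT *)

Section EulerStep.
Context {R : realType} {H : hilbertType R}.
Implicit Types (x y z : H) (h c : R).

(** The Euler step of size h for the group exp (ihT). *)
Definition istep (T : H -> H) h x := x + (0 +i* h) *: T x.

Lemma sqn_istep (T : H -> H) h x :
  sqn (istep T h x) = sqn x - 2 * h * Im (inner H (T x) x) + h ^+ 2 * sqn (T x).
Proof. by rewrite sqnD sqn_i rdot_il; ring. Qed.

Lemma istep_adj (T T' : H -> H) h x z :
  adjoint_pair T T' ->
  rdot (istep T h x) z = rdot x (istep T' (- h) z).
Proof.
move=> TT'; rewrite rdotDl rdotDr (rdotC x (_ *: _)) !rdot_il TT' (innerC x).
by case: (inner H (T' z) x) => a b /=; ring.
Qed.

(** The operator V = 1 + ihT and its adjoint V' = 1 - ihT' inherit the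
inequality |V'y| <= |Vy|, because the cross terms of both squares are equal.
Then |Vx|^2 = <x, V'Vx> <= |x| |V'Vx| <= |x| |VVx|. *)
Lemma istep_log_convex (T T' : H -> H) h x :
  adjoint_pair T T' ->
  (forall x, rnorm (T' x) <= rnorm (T x)) ->
  sqn (istep T h x) ^+ 2 <= sqn x * sqn (istep T h (istep T h x)).
Proof.
move=> TT' hypo.
have cohypo y : rnorm (istep T' (- h) y) <= rnorm (istep T h y).
  rewrite ler_rnorm ?rnorm_ge0 // -sqnE !sqn_istep TT' (innerC y) sqrrN.
  have : h ^+ 2 * sqn (T' y) <= h ^+ 2 * sqn (T y).
    by rewrite ler_wpM2l ?sqr_ge0 // !sqnE lerXn2r ?nnegrE ?rnorm_ge0.
  by case: (inner H (T' y) y) => a b /=; lra.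
set y := istep T h x.
have : sqn y <= rnorm x * rnorm (istep T h y).
  rewrite {1}/sqn {1}/y (istep_adj _ _ _ TT').
  by apply: le_trans (rdot_le _ _) _; rewrite ler_wpM2l ?rnorm_ge0.
move=> le_y; rewrite (sqnE x) (sqnE (istep T h y)) -exprMn.
by rewrite lerXn2r ?nnegrE ?sqn_ge0 ?mulr_ge0 ?rnorm_ge0.
Qed.

Lemma iter_istep_commute (A : {linear H -> H}) (S T : H -> H) h :
  (forall x, A (S x) = T (A x)) ->
  forall n x, A (iter n (istep S h) x) = iter n (istep T h) (A x).
Proof.
move=> AS; elim=> [//|n IH] x /=.
by rewrite /istep linearD linearZ /= AS IH.
Qed.

(** The growth rate 1 + c h^2 has no term of first order in h, and by
log-convexity it bounds |x + ihTx| / |x|. The first order term of the latter is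
a nonzero multiple of h Im <Tx,x>, so Im <Tx,x> must vanish. The polynomial
factor may depend on h, since only the rate matters. *)
Lemma hyponormal_slow_symmetric (T : {linear H -> H}) (T' : H -> H) c :
  0 <= c ->
  adjoint_pair T T' ->
  (forall x, rnorm (T' x) <= rnorm (T x)) ->
  (forall h, exists2 K, 0 <= K & forall n x,
    rnorm (iter n (istep T h) x) <=
    (1 + n%:R * K) * (1 + c * h ^+ 2) ^+ n * rnorm x) ->
  symmetric T.
Proof.
move=> c0 TT' hypo slow; apply: symmetric_real => x.
set m := Im _.
have step h : sqn (istep T h x) <= (1 + c * h ^+ 2) ^+ 2 * sqn x.
  have [K K0 Kb] := slow h.
  have b0 : 0 < 1 + c * h ^+ 2 by rewrite ltr_wpDr // mulr_ge0 ?sqr_ge0.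
  apply: (@log_convex_growth _ (fun n => sqn (iter n (istep T h) x)) K)
    => // [n|n||n].
  - exact: sqn_ge0.
  - exact: istep_log_convex TT' hypo.
  - by rewrite exprn_gt0.
  - rewrite /= !sqnE -exprM mulnC exprM -!exprMn lerXn2r ?nnegrE ?rnorm_ge0 //.
    by rewrite !mulr_ge0 ?addr_ge0 ?mulr_ge0 ?exprn_ge0 ?rnorm_ge0 // ltW.
apply/eqP/negP => /negP m0.
pose k := (2 * c + c ^+ 2) * sqn x.
have k0 : 0 <= k by rewrite mulr_ge0 ?sqn_ge0 // addr_ge0 ?mulr_ge0 ?sqr_ge0.
have quad h : h ^+ 2 <= 1 -> - 2 * h * m <= k * h ^+ 2.
  move=> h1; have := step h; rewrite sqn_istep -/m.
  have h20 := sqr_ge0 h; have := mulr_ge0 h20 (sqn_ge0 (T x)).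
  have : c ^+ 2 * (h ^+ 2 * h ^+ 2) * sqn x <= c ^+ 2 * h ^+ 2 * sqn x.
    by rewrite ler_wpM2r ?sqn_ge0 // ler_wpM2l ?sqr_ge0 // ler_piMr.
  by rewrite /k; lra.
(* The step h = - m e has the sign that makes - 2 h m positive; e is so small
   that |h| <= 1 and k e < 1, so that the linear term beats k h^2. *)
pose e := (k + 1 + `|m|)^-1.
have p0 : 0 < k + 1 + `|m| by rewrite ltr_wpDr // ltr_wpDl.
have e0 : 0 < e by rewrite invr_gt0.
have ke : k * e < 1.
  by rewrite ltr_pdivrMr // mul1r -addrA ltrDl ltr_wpDr.
have me : `|m| * e <= 1.
  by rewrite ler_pdivrMr // mul1r lerDr addr_ge0.
have := quad (- m * e).
rewrite exprMn sqrrN -[in X in X -> _]real_normK ?num_real // -exprMn.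
rewrite exprn_ile1 ?mulr_ge0 ?(ltW e0) // => /(_ isT).
apply/negP; rewrite -ltNge.
rewrite exprMn real_normK ?num_real //.
have m2 : 0 < m ^+ 2 by rewrite exprn_even_gt0.
have : k * e * (m ^+ 2 * e) < 1 * (m ^+ 2 * e) by rewrite ltr_pM2r // mulr_gt0.
have : 0 < m ^+ 2 * e by rewrite mulr_gt0.
by lra.
Qed.

End EulerStep.

(** * Growth of the powers of 1 + ihBA and 1 + ihAB *)

Section PositiveProduct.
Context {R : realType} {H : hilbertType R}.
Variables (A B : {linear H -> H}) (a b : R).
Hypotheses (a0 : 0 < a) (Aa : forall x, rnorm (A x) <= a * rnorm x).
Hypotheses (b0 : 0 < b) (Bb : forall x, rnorm (B x) <= b * rnorm x).
Hypotheses (A_positive : positive_operator A) (A_sym : symmetric A).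
Hypothesis B_sym : symmetric B.
Implicit Types (x y z : H) (h : R).

Let p x : R := rdot (A x) x.
Let c : R := a ^+ 2 * b ^+ 2.

Let c_ge0 : 0 <= c.
Proof. by rewrite mulr_ge0 ?sqr_ge0. Qed.

Let p_ge0 x : 0 <= p x.
Proof. by have := A_positive x; rewrite lecE => /andP[]. Qed.

Let p_le x : p x <= a * sqn x.
Proof.
apply: le_trans (rdot_le _ _) _.
by rewrite sqnE expr2 mulrA ler_wpM2r ?rnorm_ge0.
Qed.

(** Expanding <A(x - tAx), x - tAx> >= 0 with t = 1/a, the minimizer of the
resulting bound. *)
Let sqn_le x : sqn (A x) <= a * p x.
Proof.
have := p_ge0 (x + (- a^-1)%:C *: A x).
have -> : p (x + (- a^-1)%:C *: A x) =
    p x - 2 * (a^-1 * sqn (A x)) + a^-1 * a^-1 * p (A x).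
  have AA : rdot (A (A x)) x = sqn (A x) by rewrite /rdot A_sym.
  by rewrite /p linearD linearZ /= rdotDl !rdotDr !rdotZl !rdotZr AA /sqn; ring.
have le1 : a^-1 * a^-1 * p (A x) <= a^-1 * sqn (A x).
  by rewrite -mulrA ler_wpM2l ?invr_ge0 ?(ltW a0) // ler_pdivrMl.
move=> pos.
have : a^-1 * sqn (A x) <= p x by lra.
by rewrite ler_pdivrMl.
Qed.

(** For the form <Ax,y> the operator BA is symmetric, so the terms of first
order in h cancel, as for the modulus of 1 + ih s with s real. *)
Let p_istep h x : p (istep (B \o A) h x) <= (1 + c * h ^+ 2) * p x.
Proof.
have im0 : Im (inner H (B (A x)) (A x)) = 0.
  have /(congr1 (@complex.Im R)) :
      inner H (B (A x)) (A x) = (inner H (B (A x)) (A x))^*.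
    by rewrite {1}B_sym innerC.
  by case: (inner H (B (A x)) (A x)) => u v /=; lra.
have -> : p (istep (B \o A) h x) = p x + h ^+ 2 * p (B (A x)).
  rewrite /p /istep /= linearD linearZ /= rdotDl !rdotDr rdot_ii.
  rewrite (rdotC (A x) (_ *: _)) !rdot_il A_sym im0; ring.
have : p (B (A x)) <= c * p x.
  apply: le_trans (p_le _) _; rewrite /c.
  have : sqn (B (A x)) <= b ^+ 2 * sqn (A x).
    by rewrite !sqnE -exprMn lerXn2r ?nnegrE ?mulr_ge0 ?rnorm_ge0 // ltW.
  move=> /le_trans/(_ (ler_wpM2l (sqr_ge0 b) (sqn_le x))).
  by rewrite -(ler_pM2l a0); lra.
move=> /(ler_wpM2l (sqr_ge0 h)); lra.
Qed.

(** The form <Ax,x> controls only |Ax| and not |x|: hence the factor [A] on the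
left, which the growth lemmas remove at the price of a factor linear in n. *)
Lemma iter_istep_mulA_le h n x :
  rnorm (A (iter n (istep (B \o A) h) x)) <=
  a * (1 + c * h ^+ 2) ^+ n * rnorm x.
Proof.
have q0 : 0 <= c * h ^+ 2 by rewrite mulr_ge0 ?sqr_ge0.
have q1 : 1 <= 1 + c * h ^+ 2 by rewrite lerDl.
have pn : p (iter n (istep (B \o A) h) x) <= (1 + c * h ^+ 2) ^+ n * p x.
  elim: n => [|n IH]; first by rewrite mul1r.
  apply: le_trans (p_istep _ _) _.
  by rewrite [_ ^+ n.+1]exprS -[leRHS]mulrA ler_wpM2l // (le_trans ler01).
have qn : 1 <= (1 + c * h ^+ 2) ^+ n by rewrite exprn_ege1.
rewrite ler_rnorm; last first.
  by rewrite !mulr_ge0 ?rnorm_ge0 ?(ltW a0) // (le_trans ler01).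
apply: le_trans (sqn_le _) _; rewrite !exprMn -sqnE.
have : (1 + c * h ^+ 2) ^+ n * p x <=
    ((1 + c * h ^+ 2) ^+ n) ^+ 2 * (a * sqn x).
  apply: ler_pM => //; first exact: le_trans qn.
  by rewrite expr2 ler_peMl // (le_trans ler01).
move=> /(le_trans pn); rewrite -(ler_pM2l a0) => /le_trans; apply.
by rewrite le_eqVlt; apply/orP; left; apply/eqP; ring.
Qed.

Lemma istep_BA_growth h : exists2 K, 0 <= K & forall n x,
  rnorm (iter n (istep (B \o A) h) x) <=
  (1 + n%:R * K) * (1 + c * h ^+ 2) ^+ n * rnorm x.
Proof.
exists (`|h| * b * a); first by rewrite !mulr_ge0 ?(ltW a0) ?(ltW b0).
move=> n x; apply: (@geometric_increments_le _
  (fun n => rnorm (iter n (istep (B \o A) h) x))) => {n}.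
- by rewrite lerDl mulr_ge0 ?sqr_ge0.
- exact: rnorm_ge0.
- by rewrite !mulr_ge0 ?(ltW a0) ?(ltW b0).
move=> n; rewrite iterS {1}/istep; apply: le_trans (rnormD _ _) _.
rewrite lerD2l rnorm_i.
move: (iter_istep_mulA_le h n x); move: (1 + c * h ^+ 2) => q le_q.
rewrite -!mulrA ler_wpM2l //; apply: le_trans (Bb _) _.
by rewrite ler_wpM2l ?(ltW b0) // mulrA.
Qed.

(** With V = 1 + ihBA and W = 1 + ihAB, one has AV = WA, hence
W^(n+1) = W^n + ih W^n A B = W^n + ih (A V^n) B. *)
Lemma istep_AB_growth h : exists2 K, 0 <= K & forall n x,
  rnorm (iter n (istep (A \o B) h) x) <=
  (1 + n%:R * K) * (1 + c * h ^+ 2) ^+ n * rnorm x.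
Proof.
exists (`|h| * a * b); first by rewrite !mulr_ge0 ?(ltW a0) ?(ltW b0).
have AV n x := @iter_istep_commute _ _ A (B \o A) (A \o B) h (fun=> erefl) n x.
have telescope n x : iter n.+1 (istep (A \o B) h) x =
    iter n (istep (A \o B) h) x +
    (0 +i* h) *: A (iter n (istep (B \o A) h) (B x)).
  elim: n => [//|n IH]; rewrite [LHS]iterS [in LHS]IH.
  rewrite AV [in RHS]AV !(iterS n); set y := iter n _ x; set z := iter n _ _.
  by rewrite /istep /= !linearD !linearZ /= addrACA.
move=> n x; apply: (@geometric_increments_le _
  (fun n => rnorm (iter n (istep (A \o B) h) x))) => {n}.
- by rewrite lerDl mulr_ge0 ?sqr_ge0.
- exact: rnorm_ge0.
- by rewrite !mulr_ge0 ?(ltW a0) ?(ltW b0).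
move=> n; rewrite telescope; apply: le_trans (rnormD _ _) _.
rewrite lerD2l rnorm_i.
have : 0 <= 1 + c * h ^+ 2 by rewrite addr_ge0 // mulr_ge0 ?sqr_ge0.
move: (iter_istep_mulA_le h n (B x)); move: (1 + c * h ^+ 2) => q le_q q0.
rewrite -!mulrA ler_wpM2l //; apply: le_trans le_q _.
by rewrite -mulrA ler_wpM2l ?(ltW a0) // mulrCA ler_wpM2l ?Bb ?exprn_ge0.
Qed.

End PositiveProduct.

(** * Hyponormal products *)

Section SelfAdjoint.
Context {R : realType} {H : hilbertType R}.

Lemma adjoint_eq (T T' : H -> H) :
  adjoint_pair T T' -> adjoint T = T'.
Proof. by move=> TT'; apply/funext => y; apply: adjoint_unique. Qed.

Lemma hyponormal_rnorm (T T' : H -> H) :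
  adjoint_pair T T' -> hyponormal T ->
  forall x, rnorm (T' x) <= rnorm (T x).
Proof.
by move=> /adjoint_eq TT' hypo x; have := hypo x; rewrite TT' !normE lecR.
Qed.

End SelfAdjoint.

Theorem proposition1p8 (R : realType) (H : hilbertType R)
    (H_separable : separable H) (H_infinite : infinite_dimensional H)
    (A B : {linear H -> H})
    (A_bounded : bounded_operator A) (B_bounded : bounded_operator B)
    (A_positive : positive_operator A) (B_self_adjoint : self_adjoint B) :
  (hyponormal (A \o B) -> self_adjoint (A \o B)) /\
  (hyponormal (B \o A) -> self_adjoint (B \o A)).
Proof.
have [a a0 Aa] := bounded_operator_real A_bounded.
have [b b0 Bb] := bounded_operator_real B_bounded.
have A_sym : symmetric A.
  apply: symmetric_real => x; have := A_positive x.
  by rewrite lecE => /andP[/eqP].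
have B_sym : symmetric B.
  by move=> x y; rewrite adjointP // B_self_adjoint.
have c0 : 0 <= a ^+ 2 * b ^+ 2 by rewrite mulr_ge0 ?sqr_ge0.
have AB_adj : adjoint_pair (A \o B) (B \o A).
  by move=> x y; rewrite /= A_sym B_sym.
have BA_adj : adjoint_pair (B \o A) (A \o B).
  by move=> x y; rewrite /= B_sym A_sym.
split=> hypo; apply: adjoint_eq.
- apply: (hyponormal_slow_symmetric c0 AB_adj (hyponormal_rnorm AB_adj hypo)).
  exact: istep_AB_growth.
- apply: (hyponormal_slow_symmetric c0 BA_adj (hyponormal_rnorm BA_adj hypo)).
  exact: istep_BA_growth.
Qed.
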